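(* For every nonzero real number $x$, $$\left.\frac{\partial \mathrm{Wi}_{\alpha,\beta}(x)}{\partial\alpha}\right|_{\alpha=1,\ \beta=2}=1-\gamma-\frac{I_0(2\sqrt x)}{2x}+\frac{2K_1(2\sqrt x)-\ln x\,I_1(2\sqrt x)}{2\sqrt x}.$$
   Context: The integral Wright function is $\mathrm{Wi}_{\alpha,\beta}(x)=\sum_{k=1}^\infty\frac{x^k}{k\,k!\,\Gamma(\alpha k+\beta)}$ (with $1/\Gamma=0$ at the poles of $\Gamma$), so that $\frac{\partial \mathrm{Wi}_{\alpha,\beta}(x)}{\partial\alpha}=-\sum_{k=1}^\infty\frac{\psi(\alpha k+\beta)}{k!\,\Gamma(\alpha k+\beta)}x^k$, with $\psi=\Gamma'/\Gamma$ the digamma function. $\gamma$ is the Euler-Mascheroni constant; $I_\nu$ and $K_\nu$ are the modified Bessel functions of the first and second kind. For $x<0$, $\ln x$ and $\sqrt x$ denote principal branches. *)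

(* Defs.v *)
From Stdlib Require Import Reals ZArith.
From Coquelicot Require Import Coquelicot.

Open Scope R_scope.

(* Limit as n -> oo of 1 + 1/2 + ... + 1/(n+1) - ln (n+1). *)
Definition EulerGamma : R :=
  Lim_seq (fun n => sum_f_R0 (fun k => / INR (S k)) n - ln (INR (S n))).

(* Euler's integral; it is the Gamma function for s > 0 only. *)
Definition Gamma_int (s : R) : R :=
  RInt_gen (fun t => Rpower t (s - 1) * exp (- t))
           (at_right 0) (Rbar_locally p_infty).

(* s (s + 1) ... (s + n - 1) *)
Fixpoint rising (s : R) (n : nat) : R :=
  match n with
  | O => 1
  | S m => rising s m * (s + INR m)
  end.

(* 1 / Gamma on the whole real line. Gamma is continued to s <= 0 by
   Gamma(s) = Gamma(s + n) / (s (s + 1) ... (s + n - 1)), where n is the least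
   natural number such that s + n > 0 (so n = 0 for s > 0). The product
   vanishes at the poles s = 0, -1, -2, ..., giving 1 / Gamma = 0 there. *)
Definition rGamma (s : R) : R :=
  let n := Z.to_nat (up (- s)) in
  rising s n / Gamma_int (s + INR n).

(* The series starts at k = 1. *)
Definition Wi (alpha beta x : R) : R :=
  Series (fun n =>
    let k := S n in
    x ^ k / (INR k * INR (fact k)) * rGamma (alpha * INR k + beta)).

Definition Cexp (z : C) : C :=
  (exp (Re z) * cos (Im z), exp (Re z) * sin (Im z)).

(* Principal argument, in (-PI, PI], of z <> 0. *)
Definition Carg (z : C) : R :=
  if Rle_dec 0 (Im z) then acos (Re z / Cmod z) else - acos (Re z / Cmod z).

(* Principal branches; meaningful for z <> 0. *)
Definition Cln (z : C) : C := (ln (Cmod z), Carg z).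

Definition Cpower (z : C) (a : R) : C := Cexp (RtoC a * Cln z)%C.

Definition Csqrt (z : C) : C := Cpower z (1 / 2).

Definition CSeries (a : nat -> C) : C :=
  (Series (fun n => Re (a n)), Series (fun n => Im (a n))).

(* Limit of f mu as mu -> nu, mu <> nu. *)
Definition CLim (f : R -> C) (nu : R) : C :=
  (real (Lim (fun mu => Re (f mu)) nu), real (Lim (fun mu => Im (f mu)) nu)).

(* Modified Bessel functions of real order nu and argument z <> 0. *)
Definition BesselI (nu : R) (z : C) : C :=
  (Cpower (z / 2) nu *
   CSeries (fun k =>
     (z * z / 4) ^ k * RtoC (rGamma (INR k + nu + 1) / INR (fact k))))%C.

(* At integer nu, where sin (nu PI) = 0, K_nu is the limiting value of
   (PI / 2) (I_{-mu} - I_mu) / sin (mu PI) as mu -> nu; at other nu the limit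
   is the value of this expression at mu = nu. *)
Definition BesselK (nu : R) (z : C) : C :=
  CLim (fun mu =>
    RtoC (PI / 2) * (BesselI (- mu) z - BesselI mu z) / RtoC (sin (mu * PI)))%C
    nu.

(* Main.v *)
Require Import Defs.
From Stdlib Require Import Reals Factorial Lra Lia.
From Coquelicot Require Import Coquelicot.
Open Scope R_scope.

(** Write [D k] for the derivative of 1 / Gamma at the integer [k]. Both sides
    of the identity are power series in [x] built from the numbers [D k], and
    the only relations that connect them are
    [D k = 1 / Gamma (k + 1) + k * D (k + 1)], the derivative of
    1 / Gamma (s) = s / Gamma (s + 1), and [D 2 = EulerGamma - 1].

    Left side. Termwise differentiation gives
    d = sum over k >= 1 of x^k / k! * D (k + 2).

    Right side. Let L be the principal logarithm of x, w = exp (L / 2) its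
    square root, and S nu the sum over k >= 0 of
    x^k / k! / Gamma (k + nu + 1). Then I_nu (2 w) = exp (nu L / 2) * S nu,
    because the principal logarithm of w is L / 2. The numerator
    exp (- mu L / 2) * S (- mu) - exp (mu L / 2) * S mu of K_mu vanishes at
    mu = 1, as does sin (mu PI), so K_1 is a quotient of derivatives:
    2 K_1 = L I_1 + A / w + w B, where A and B are the sums over k >= 0 of
    x^k / k! * D k and x^k / k! * D (k + 2). The recurrence for D gives
    A = S 0 + x B, and B = EulerGamma - 1 + d. Substituting leaves d.

    The analytic input is therefore small: 1 / Gamma has to be differentiated
    at integers only, and the two termwise differentiations need nothing but a
    Lipschitz bound with geometric growth, which the factorials absorb. Both
    come from the convexity of ln Gamma on the positive half-line
    ([lnGamma_convex]), read off from Euler's integral. As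
    ln Gamma (s + 1) - ln Gamma (s) = ln s, convexity confines the chord slopes
    near s to ln s up to O (1 / s); transporting this from a large integer down
    to 1 gives the derivative - EulerGamma there ([lnGamma_derive_1]). *)

(** * Euler's integral *)

(** For a nonnegative integrand the proper integrals grow with the interval, so
    the improper integral is their least upper bound. Characterizing it by upper
    bounds lets inequalities between integrands pass to the limit without any
    further convergence argument. *)
Lemma improper_RInt_of_bounded (f : R -> R) (M : R) :
  (forall t, 0 < t -> continuous f t) ->
  (forall t, 0 < t -> 0 <= f t) ->
  (forall a b, 0 < a -> a <= b -> RInt f a b <= M) ->
  exists l, is_RInt_gen f (at_right 0) (Rbar_locally p_infty) l /\
    (forall a b, 0 < a -> a <= b -> RInt f a b <= l) /\
    (forall M', (forall a b, 0 < a -> a <= b -> RInt f a b <= M') -> l <= M').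
Proof.
  intros Hc Hp Hb.
  assert (Hex : forall a b, 0 < a -> a <= b -> ex_RInt f a b).
  { intros a b Ha Hab. apply (ex_RInt_continuous (V := R_CompleteNormedModule)).
    intros z Hz. apply Hc. rewrite Rmin_left in Hz; lra. }
  assert (Hmono : forall a b a' b', 0 < a' -> a' <= a -> a <= b -> b <= b' ->
            RInt f a b <= RInt f a' b').
  { intros a b a' b' H0 H1 H2 H3.
    rewrite <- (RInt_Chasles f a' a b') by (apply Hex; lra).
    rewrite <- (RInt_Chasles f a b b') by (apply Hex; lra).
    assert (0 <= RInt f a' a).
    { apply RInt_ge_0; [lra | apply Hex; lra | intros; apply Hp; lra]. }
    assert (0 <= RInt f b b').
    { apply RInt_ge_0; [lra | apply Hex; lra | intros; apply Hp; lra]. }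
    unfold plus; simpl; lra. }
  destruct (completeness (fun y => exists a b, 0 < a /\ a <= b /\ y = RInt f a b))
    as [l [Hub Hlub]].
  { exists M. intros y (a & b & Ha & Hab & ->). now apply Hb. }
  { exists (RInt f 1 1), 1, 1. repeat split; lra. }
  assert (Hle : forall a b, 0 < a -> a <= b -> RInt f a b <= l).
  { intros a b Ha Hab. apply Hub. now exists a, b. }
  exists l. split; [|split]; [ | exact Hle | ].
  2:{ intros M' HM'. apply Hlub. intros y (a & b & Ha & Hab & ->). now apply HM'. }
  intros P [eps HP].
  assert (H : exists a b, 0 < a /\ a <= b /\ l - eps < RInt f a b).
  { apply Classical_Prop.NNPP. intros Hn.
    assert (l <= l - eps).
    { apply Hlub. intros y (a & b & Ha & Hab & ->).
      apply Rnot_lt_le. intros Hlt. apply Hn. now exists a, b. }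
    destruct eps; simpl in *; lra. }
  destruct H as (a0 & b0 & Ha0 & Hab0 & Hl0).
  apply Filter_prod with (Q := fun a => 0 < a <= a0) (R := fun b => b0 < b).
  - exists (mkposreal a0 Ha0). intros y Hy Hy0. split; [exact Hy0|].
    apply Rabs_def2 in Hy. unfold minus, plus, opp in Hy; simpl in Hy. lra.
  - exists b0. intros; lra.
  - intros a b Ha Hb0. simpl. exists (RInt f a b). split.
    + apply (RInt_correct f). apply Hex; lra.
    + apply HP. apply Rabs_def1; unfold minus, plus, opp; simpl.
      * assert (RInt f a b <= l) by (apply Hle; lra). destruct eps; simpl in *; lra.
      * assert (RInt f a0 b0 <= RInt f a b) by (apply Hmono; lra). lra.
Qed.

Definition gamma_integrand (s t : R) : R := Rpower t (s - 1) * exp (- t).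

Lemma gamma_integrand_pos (s t : R) : 0 < gamma_integrand s t.
Proof. apply Rmult_lt_0_compat; apply exp_pos. Qed.

Lemma gamma_integrand_continuous (s t : R) :
  0 < t -> continuous (gamma_integrand s) t.
Proof.
  intros Ht. apply (ex_derive_continuous (V := R_NormedModule)).
  unfold gamma_integrand, Rpower. auto_derive. exact Ht.
Qed.

Lemma gamma_integrand_ex_RInt (s a b : R) :
  0 < a -> a <= b -> ex_RInt (gamma_integrand s) a b.
Proof.
  intros Ha Hab. apply (ex_RInt_continuous (V := R_CompleteNormedModule)).
  intros z Hz. apply gamma_integrand_continuous. rewrite Rmin_left in Hz; lra.
Qed.

Lemma ln_le_sub1 (y : R) : 0 < y -> ln y <= y - 1.
Proof.
  intros Hy. pose proof (exp_ineq1_le (ln y)). rewrite exp_ln in H; lra.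
Qed.

Lemma exp_le_mono (x y : R) : x <= y -> exp x <= exp y.
Proof. intros [H| ->]; [left; now apply exp_increasing | right; reflexivity]. Qed.

(** Since ln y <= y - 1 at y = t / (2 (s - 1)), the power t^(s - 1) is at most a
    constant times exp (t / 2). *)
Lemma gamma_integrand_le_exp (s : R) : 1 < s ->
  exists C, 0 < C /\ forall t, 0 < t -> gamma_integrand s t <= C * exp (- (t / 2)).
Proof.
  intros Hs. exists (exp ((s - 1) * ln (2 * (s - 1)))). split; [apply exp_pos|].
  intros t Ht. unfold gamma_integrand, Rpower. rewrite <- !exp_plus.
  apply exp_le_mono.
  assert (H : ln (t / (2 * (s - 1))) <= t / (2 * (s - 1)) - 1).
  { apply ln_le_sub1. apply Rdiv_lt_0_compat; lra. }
  rewrite ln_div in H by lra.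
  apply (Rmult_le_compat_l (s - 1)) in H; [|lra].
  replace ((s - 1) * (t / (2 * (s - 1)) - 1)) with (t / 2 - (s - 1)) in H
    by (field; lra).
  lra.
Qed.

Lemma gamma_RInt_bounded_gt1 (s : R) : 1 < s ->
  exists M, forall a b, 0 < a -> a <= b -> RInt (gamma_integrand s) a b <= M.
Proof.
  intros Hs. destruct (gamma_integrand_le_exp s Hs) as (C & HC & Hle).
  exists (2 * C). intros a b Ha Hab.
  assert (HI : is_RInt (fun t => C * exp (- (t / 2))) a b
     (minus (-2 * C * exp (- (b / 2))) (-2 * C * exp (- (a / 2))))).
  { apply (is_RInt_derive (fun t => -2 * C * exp (- (t / 2)))).
    - intros t _. auto_derive; [trivial|]. unfold Rdiv. field.
    - intros t _. apply (ex_derive_continuous (V := R_NormedModule)).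
      auto_derive; trivial. }
  apply Rle_trans with (RInt (fun t => C * exp (- (t / 2))) a b).
  - apply RInt_le; [exact Hab | now apply gamma_integrand_ex_RInt
                   | eexists; exact HI |].
    intros t Ht. apply Hle; lra.
  - rewrite (is_RInt_unique _ _ _ _ HI). unfold minus, plus, opp; simpl.
    pose proof (exp_pos (- (b / 2))).
    assert (exp (- (a / 2)) <= 1) by (rewrite <- exp_0; apply exp_le_mono; lra).
    nra.
Qed.

Lemma gamma_integrand_succ (s t : R) : 0 < t ->
  gamma_integrand (s + 1) t = t * gamma_integrand s t.
Proof.
  intros Ht. unfold gamma_integrand, Rpower.
  replace (s + 1 - 1) with ((s - 1) + 1) by ring.
  rewrite Rmult_plus_distr_r, exp_plus, Rmult_1_l, exp_ln by exact Ht. ring.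
Qed.

Lemma gamma_primitive_derive (s t : R) : 0 < t ->
  is_derive (gamma_integrand (s + 1)) t
    (s * gamma_integrand s t - gamma_integrand (s + 1) t).
Proof.
  intros Ht. rewrite gamma_integrand_succ by exact Ht.
  unfold gamma_integrand, Rpower.
  auto_derive; [exact Ht|].
  replace ((s + 1 - 1) * ln t) with ((s - 1) * ln t + ln t) by ring.
  rewrite exp_plus, exp_ln by exact Ht.
  field. lra.
Qed.

(** This one identity serves twice: it bounds the integrals for 0 < s <= 1 by
    those at s + 1, so the singularity at 0 needs no separate estimate, and its
    limit is the functional equation. *)
Lemma gamma_by_parts (s a b : R) : 0 < a -> a <= b ->
  s * RInt (gamma_integrand s) a b - RInt (gamma_integrand (s + 1)) a b
  = gamma_integrand (s + 1) b - gamma_integrand (s + 1) a.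
Proof.
  intros Ha Hab.
  assert (Hc : forall r z, Rmin a b <= z <= Rmax a b ->
             continuous (gamma_integrand r) z).
  { intros r z Hz. apply gamma_integrand_continuous.
    rewrite Rmin_left in Hz; lra. }
  assert (H := is_RInt_derive (gamma_integrand (s + 1))
    (fun t => s * gamma_integrand s t - gamma_integrand (s + 1) t) a b).
  assert (HI : is_RInt (fun t => s * gamma_integrand s t - gamma_integrand (s + 1) t)
    a b (s * RInt (gamma_integrand s) a b - RInt (gamma_integrand (s + 1)) a b)).
  { apply (is_RInt_minus (V := R_NormedModule)).
    - apply (is_RInt_scal (V := R_NormedModule)). apply (RInt_correct (gamma_integrand s)).
      now apply gamma_integrand_ex_RInt.
    - apply (RInt_correct (gamma_integrand (s + 1))).
      now apply gamma_integrand_ex_RInt. }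
  rewrite <- (is_RInt_unique _ _ _ _ HI).
  apply is_RInt_unique, H.
  - intros t Ht. apply gamma_primitive_derive. rewrite Rmin_left in Ht; lra.
  - intros t Ht. apply (continuous_minus (V := R_NormedModule)).
    + apply (continuous_scal_r s (gamma_integrand s)). now apply Hc.
    + now apply Hc.
Qed.

Lemma gamma_RInt_bounded (s : R) : 0 < s ->
  exists M, forall a b, 0 < a -> a <= b -> RInt (gamma_integrand s) a b <= M.
Proof.
  intros Hs. destruct (gamma_RInt_bounded_gt1 (s + 1)) as [M HM]; [lra|].
  destruct (gamma_integrand_le_exp (s + 1)) as (C & HC & Hle); [lra|].
  exists ((C + M) / s). intros a b Ha Hab.
  apply Rmult_le_reg_l with s; [exact Hs|].
  replace (s * ((C + M) / s)) with (C + M) by (field; lra).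
  pose proof (gamma_by_parts s a b Ha Hab).
  specialize (HM a b Ha Hab). specialize (Hle b ltac:(lra)).
  pose proof (gamma_integrand_pos (s + 1) a).
  assert (exp (- (b / 2)) <= 1) by (rewrite <- exp_0; apply exp_le_mono; lra).
  nra.
Qed.

(** The form in which the value of Euler's integral is used below. *)
Lemma Gamma_int_lub (s : R) : 0 < s ->
  is_RInt_gen (gamma_integrand s) (at_right 0) (Rbar_locally p_infty) (Gamma_int s) /\
  (forall a b, 0 < a -> a <= b -> RInt (gamma_integrand s) a b <= Gamma_int s) /\
  (forall M, (forall a b, 0 < a -> a <= b -> RInt (gamma_integrand s) a b <= M) ->
     Gamma_int s <= M).
Proof.
  intros Hs. destruct (gamma_RInt_bounded s Hs) as [M HM].
  destruct (improper_RInt_of_bounded (gamma_integrand s) M) as (l & Hl & H).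
  - apply gamma_integrand_continuous.
  - intros; left; apply gamma_integrand_pos.
  - exact HM.
  - replace (Gamma_int s) with l; [easy|].
    symmetry.
    exact (is_RInt_gen_unique (V := R_CompleteNormedModule)
      (Fa := at_right 0) (Fb := Rbar_locally p_infty) (gamma_integrand s) l Hl).
Qed.

Lemma Gamma_int_pos (s : R) : 0 < s -> 0 < Gamma_int s.
Proof.
  intros Hs. apply Rlt_le_trans with (RInt (gamma_integrand s) 1 2).
  - apply RInt_gt_0; [lra | intros; apply gamma_integrand_pos |].
    intros t Ht. apply gamma_integrand_continuous; lra.
  - apply (Gamma_int_lub s Hs); lra.
Qed.

Lemma is_lim_exp_neg_scal (c : R) : 0 < c ->
  is_lim (fun t => exp (- (t * c))) p_infty 0.
Proof.
  intros Hc.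
  apply (is_lim_comp exp (fun t => - (t * c)) p_infty 0 m_infty).
  - apply is_lim_exp_m.
  - replace m_infty with (Rbar_opp p_infty) by reflexivity.
    apply is_lim_opp.
    replace p_infty with (Rbar_mult p_infty c) at 2.
    apply is_lim_scal_r. apply is_lim_id.
    simpl. case Rle_dec; [intros h; case Rle_lt_or_eq_dec; [easy|lra]|lra].
  - exists 0. intros; easy.
Qed.

(** The boundary term t^s exp (- t) of the integration by parts vanishes at both
    ends. *)
Lemma Gamma_int_succ (s : R) : 0 < s -> Gamma_int (s + 1) = s * Gamma_int s.
Proof.
  intros Hs.
  destruct (Gamma_int_lub s Hs) as [H1 _].
  destruct (Gamma_int_lub (s + 1)) as [H2 _]; [lra|].
  assert (H3 : is_RInt_gen (Derive (gamma_integrand (s + 1)))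
            (at_right 0) (Rbar_locally p_infty) (0 - 0)).
  { assert (Hpos : filter_prod (at_right 0) (Rbar_locally p_infty)
       (fun ab => 0 < Rmin (fst ab) (snd ab))).
    { apply Filter_prod with (Q := fun a => 0 < a) (R := fun b => 0 < b).
      - exists (mkposreal 1 Rlt_0_1). now intros.
      - exists 0. now intros.
      - intros a b Ha Hb. simpl. now apply Rmin_glb_lt. }
    apply is_RInt_gen_Derive.
    - revert Hpos. apply filter_imp. intros [a b] Hab t Ht. simpl in *.
      eexists. apply gamma_primitive_derive. lra.
    - revert Hpos. apply filter_imp. intros [a b] Hab t Ht. simpl in *.
      apply continuous_ext_loc with
        (g := fun t => s * gamma_integrand s t - gamma_integrand (s + 1) t).
      + assert (Ht0 : 0 < t) by lra. exists (mkposreal t Ht0). intros y Hy.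
        symmetry. apply is_derive_unique, gamma_primitive_derive.
        apply Rabs_def2 in Hy. unfold minus, plus, opp in Hy; simpl in Hy. lra.
      + apply (continuous_minus (V := R_NormedModule)).
        * apply (continuous_scal_r s (gamma_integrand s)).
          apply gamma_integrand_continuous; lra.
        * apply gamma_integrand_continuous; lra.
    - apply filterlim_locally. intros eps.
      (* The radius is eps^(1/s), so that t^s < eps. *)
      exists (mkposreal (exp (ln eps / s)) (exp_pos _)). intros t Ht Ht0.
      apply Rabs_def2 in Ht. unfold minus, plus, opp in Ht; simpl in Ht.
      apply Rabs_def1; unfold minus, plus, opp; simpl.
      + unfold gamma_integrand, Rpower.
        assert (exp (- t) <= 1) by (rewrite <- exp_0; apply exp_le_mono; lra).
        assert (Hln : ln t < ln eps / s).
        { rewrite <- (ln_exp (ln eps / s)). apply ln_increasing; lra. }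
        assert (exp ((s + 1 - 1) * ln t) < eps).
        { rewrite <- (exp_ln eps) by apply cond_pos. apply exp_increasing.
          replace (ln eps) with (s * (ln eps / s)) by (field; lra).
          replace (s + 1 - 1) with s by ring. now apply Rmult_lt_compat_l. }
        pose proof (exp_pos ((s + 1 - 1) * ln t)). pose proof (exp_pos (- t)). nra.
      + pose proof (gamma_integrand_pos (s + 1) t). destruct eps; simpl in *; lra.
    - destruct (gamma_integrand_le_exp (s + 1)) as (C & HC & Hle); [lra|].
      change (is_lim (gamma_integrand (s + 1)) p_infty 0).
      apply (is_lim_le_le_loc (fun _ => 0) (fun t => C * exp (- (t * (/ 2))))).
      + exists 0. intros t Ht. split; [left; apply gamma_integrand_pos|].
        now apply Hle.
      + apply is_lim_const.
      + replace (Finite 0) with (Rbar_mult C 0) by (simpl; f_equal; ring).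
        apply is_lim_scal_l. apply is_lim_exp_neg_scal. lra. }
  assert (H4 : is_RInt_gen (gamma_integrand (s + 1)) (at_right 0) (Rbar_locally p_infty)
    (s * Gamma_int s - (0 - 0))).
  { eapply is_RInt_gen_ext.
    2:{ apply (is_RInt_gen_minus (V := R_NormedModule)).
        - apply (is_RInt_gen_scal (V := R_NormedModule)). exact H1.
        - exact H3. }
    apply Filter_prod with (Q := fun a => 0 < a) (R := fun b => 0 < b).
    - exists (mkposreal 1 Rlt_0_1). now intros.
    - exists 0. now intros.
    - intros a b Ha Hb t Ht. simpl in Ht.
      assert (0 < t) by (assert (0 < Rmin a b) by (now apply Rmin_glb_lt); lra).
      erewrite is_derive_unique by (now apply gamma_primitive_derive).
      unfold minus, plus, opp, scal; simpl; unfold mult; simpl. ring. }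
  unfold Gamma_int at 1.
  transitivity (s * Gamma_int s - (0 - 0)); [|ring].
  exact (is_RInt_gen_unique (V := R_CompleteNormedModule)
    (Fa := at_right 0) (Fb := Rbar_locally p_infty) (gamma_integrand (s + 1)) _ H4).
Qed.

Lemma Gamma_int_1 : Gamma_int 1 = 1.
Proof.
  destruct (Gamma_int_lub 1 Rlt_0_1) as (_ & Hub & Hl).
  assert (HI : forall a b, 0 < a -> a <= b ->
            RInt (gamma_integrand 1) a b = exp (- a) - exp (- b)).
  { intros a b Ha Hab.
    transitivity (minus (- exp (- b)) (- exp (- a))).
    2: unfold minus, plus, opp; simpl; ring.
    apply is_RInt_unique. apply (is_RInt_derive (fun t => - exp (- t))).
    - intros t Ht. unfold gamma_integrand, Rpower.
      auto_derive; [trivial|]. replace ((1 - 1) * ln t) with 0 by ring.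
      rewrite exp_0. ring.
    - intros t Ht. apply gamma_integrand_continuous.
      rewrite Rmin_left in Ht; lra. }
  apply Rle_antisym.
  - apply Hl. intros a b Ha Hab. rewrite HI by easy.
    pose proof (exp_pos (- b)).
    assert (exp (- a) <= 1) by (rewrite <- exp_0; apply exp_le_mono; lra). lra.
  - apply le_epsilon. intros eps Heps.
    (* The interval [e, 1/e] misses mass at most e at each end. *)
    set (e := Rmin (eps / 2) (1 / 2)).
    assert (0 < e <= 1 / 2 /\ e <= eps / 2).
    { unfold e. repeat split. apply Rmin_glb_lt; lra. apply Rmin_r. apply Rmin_l. }
    specialize (Hub e (/ e) ltac:(lra)).
    assert (Hi : 2 <= / e).
    { replace 2 with (/ (1 / 2)) by field. apply Rinv_le_contravar; lra. }
    specialize (Hub ltac:(lra)). rewrite HI in Hub; [|lra|lra].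
    pose proof (exp_ineq1_le (- e)).
    assert (exp (- / e) <= e).
    { rewrite exp_Ropp. rewrite <- (Rinv_inv e) at 2. apply Rinv_le_contravar; [lra|].
      pose proof (exp_ineq1_le (/ e)). lra. }
    lra.
Qed.

(** * Convexity of ln Gamma and its derivative at 1 *)

(** Multiplying the difference quotient out makes error terms additive and
    removes the case t = a. *)
Lemma is_derive_little_o (f : R -> R) (a l : R) :
  is_derive f a l <->
  forall eps, 0 < eps -> exists delta, 0 < delta /\
    forall t, Rabs (t - a) < delta ->
      Rabs (f t - f a - l * (t - a)) <= eps * Rabs (t - a).
Proof.
  split.
  - intros H. apply is_derive_Reals in H. intros eps Heps.
    destruct (H eps Heps) as [[d Hd] Hf]. exists d. split; [exact Hd|].
    intros t Ht. destruct (Req_dec t a) as [->|Hne].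
    { rewrite !Rminus_diag, Rmult_0_r, Rminus_diag, Rabs_R0. lra. }
    assert (Hh : t - a <> 0) by lra.
    specialize (Hf (t - a) Hh Ht). replace (a + (t - a)) with t in Hf by ring.
    replace (f t - f a - l * (t - a)) with (((f t - f a) / (t - a) - l) * (t - a))
      by (field; lra).
    rewrite Rabs_mult. apply Rmult_le_compat_r; [apply Rabs_pos | lra].
  - intros H. apply is_derive_Reals. intros eps Heps.
    destruct (H (eps / 2)) as (d & Hd & Hf); [lra|].
    exists (mkposreal d Hd). intros h Hh Hhd. simpl in Hhd.
    specialize (Hf (a + h)). replace (a + h - a) with h in Hf by ring.
    specialize (Hf Hhd).
    replace ((f (a + h) - f a) / h - l) with ((f (a + h) - f a - l * h) / h)
      by (field; exact Hh).
    unfold Rdiv. rewrite Rabs_mult, Rabs_inv.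
    assert (0 < Rabs h) by now apply Rabs_pos_lt.
    apply Rle_lt_trans with (eps / 2); [|lra].
    apply Rmult_le_reg_r with (Rabs h); [easy|].
    rewrite Rmult_assoc, Rinv_l by lra. lra.
Qed.

Definition lnGamma (s : R) : R := ln (Gamma_int s).

Lemma exp_lnGamma (s : R) : 0 < s -> exp (lnGamma s) = Gamma_int s.
Proof. intros Hs. now apply exp_ln, Gamma_int_pos. Qed.

Lemma lnGamma_succ (s : R) : 0 < s -> lnGamma (s + 1) = lnGamma s + ln s.
Proof.
  intros Hs. unfold lnGamma. rewrite Gamma_int_succ, ln_mult; try easy.
  - ring.
  - now apply Gamma_int_pos.
Qed.

Lemma lnGamma_1 : lnGamma 1 = 0.
Proof. unfold lnGamma. rewrite Gamma_int_1. apply ln_1. Qed.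

Lemma lnGamma_2 : lnGamma 2 = 0.
Proof.
  replace 2 with (1 + 1) by ring. rewrite lnGamma_succ by lra.
  rewrite lnGamma_1, ln_1. ring.
Qed.

(** The graph of exp lies above its tangent at the point p u + q v. *)
Lemma exp_convex (p q u v : R) : 0 <= p -> 0 <= q -> p + q = 1 ->
  exp (p * u + q * v) <= p * exp u + q * exp v.
Proof.
  intros Hp Hq Hpq. set (w := p * u + q * v).
  assert (Ht : forall z, exp w * (1 + (z - w)) <= exp z).
  { intros z. replace (exp z) with (exp w * exp (z - w))
      by (rewrite <- exp_plus; f_equal; ring).
    apply Rmult_le_compat_l; [left; apply exp_pos | apply exp_ineq1_le]. }
  pose proof (Rmult_le_compat_l p _ _ Hp (Ht u)).
  pose proof (Rmult_le_compat_l q _ _ Hq (Ht v)).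
  replace (exp w) with
    (p * (exp w * (1 + (u - w))) + q * (exp w * (1 + (v - w)))); [lra|].
  unfold w at 2 4. replace q with (1 - p) by lra. ring.
Qed.

(** Hoelder's inequality, proved as for general integrals: normalize both
    integrands to integral at most 1 and apply the convexity of exp pointwise. *)
Lemma lnGamma_convex (p q a c : R) :
  0 < a -> 0 < c -> 0 <= p -> 0 <= q -> p + q = 1 -> 0 < p * a + q * c ->
  lnGamma (p * a + q * c) <= p * lnGamma a + q * lnGamma c.
Proof.
  intros Ha Hc Hp Hq Hpq Hb.
  rewrite <- (ln_exp (p * lnGamma a + q * lnGamma c)).
  apply ln_le; [now apply Gamma_int_pos|].
  set (P := exp (p * lnGamma a + q * lnGamma c)).
  assert (HP : 0 < P) by apply exp_pos.
  apply (Gamma_int_lub _ Hb). intros x y Hx Hxy.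
  destruct (Gamma_int_lub a Ha) as (_ & Ua & _).
  destruct (Gamma_int_lub c Hc) as (_ & Uc & _).
  specialize (Ua x y Hx Hxy). specialize (Uc x y Hx Hxy).
  pose proof (Gamma_int_pos a Ha) as Pa. pose proof (Gamma_int_pos c Hc) as Pc.
  assert (HI : is_RInt (fun t => P * p / Gamma_int a * gamma_integrand a t
                               + P * q / Gamma_int c * gamma_integrand c t) x y
    (P * p / Gamma_int a * RInt (gamma_integrand a) x y
     + P * q / Gamma_int c * RInt (gamma_integrand c) x y)).
  { apply (is_RInt_plus (V := R_NormedModule)).
    - apply (is_RInt_scal (V := R_NormedModule)).
      apply (RInt_correct (gamma_integrand a)). now apply gamma_integrand_ex_RInt.
    - apply (is_RInt_scal (V := R_NormedModule)).
      apply (RInt_correct (gamma_integrand c)). now apply gamma_integrand_ex_RInt. }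
  eapply Rle_trans.
  { apply RInt_le; [exact Hxy | now apply gamma_integrand_ex_RInt
                   | eexists; exact HI |].
    intros t Ht.
    replace (gamma_integrand (p * a + q * c) t) with
      (P * exp (p * ((a - 1) * ln t - t - lnGamma a)
                + q * ((c - 1) * ln t - t - lnGamma c))).
    2:{ unfold P, gamma_integrand, Rpower. rewrite <- !exp_plus. f_equal.
        replace q with (1 - p) by lra. ring. }
    assert (E : forall r, 0 < r -> exp ((r - 1) * ln t - t - lnGamma r)
                = gamma_integrand r t / Gamma_int r).
    { intros r Hr. unfold Rminus at 1. rewrite exp_plus, exp_Ropp, exp_lnGamma by easy.
      unfold gamma_integrand, Rpower, Rdiv. rewrite <- exp_plus. reflexivity. }
    eapply Rle_trans.
    { apply Rmult_le_compat_l; [lra|]. now apply exp_convex. }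
    rewrite !E by easy. right. field. lra. }
  rewrite (is_RInt_unique _ _ _ _ HI).
  assert (Hr : forall r I G, 0 <= r -> 0 < G -> I <= G -> P * r / G * I <= P * r).
  { intros r I G H0 HG HIG. replace (P * r) with (P * r / G * G) at 2 by (field; lra).
    apply Rmult_le_compat_l; [|easy].
    apply Rmult_le_pos; [nra | left; now apply Rinv_0_lt_compat]. }
  pose proof (Hr p _ _ Hp Pa Ua). pose proof (Hr q _ _ Hq Pc Uc). nra.
Qed.

Lemma lnGamma_chords (a b c : R) : 0 < a -> a < b -> b < c ->
  (lnGamma b - lnGamma a) * (c - b) <= (lnGamma c - lnGamma b) * (b - a).
Proof.
  intros Ha Hab Hbc.
  assert (H := lnGamma_convex ((c - b) / (c - a)) ((b - a) / (c - a)) a c Ha).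
  replace ((c - b) / (c - a) * a + (b - a) / (c - a) * c) with b in H by (field; lra).
  assert (Hi : 0 < / (c - a)) by (apply Rinv_0_lt_compat; lra).
  specialize (H ltac:(lra) ltac:(unfold Rdiv; nra) ltac:(unfold Rdiv; nra)
                ltac:(field; lra) ltac:(lra)).
  apply (Rmult_le_compat_l (c - a)) in H; [|lra].
  replace ((c - a) * ((c - b) / (c - a) * lnGamma a + (b - a) / (c - a) * lnGamma c))
    with ((c - b) * lnGamma a + (b - a) * lnGamma c) in H by (field; lra).
  lra.
Qed.

(** The chord from b to b + 1, of slope ln b, bounds all chords to its left. *)
Lemma lnGamma_slope_le (a b : R) : 0 < a -> a <= b ->
  lnGamma b - lnGamma a <= (b - a) * ln b.
Proof.
  intros Ha [Hab| <-]; [|lra].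
  pose proof (lnGamma_chords a b (b + 1) Ha Hab ltac:(lra)) as H.
  rewrite lnGamma_succ in H by lra. lra.
Qed.

(** The chord from a - 1 to a, of slope ln (a - 1), bounds all chords to its
    right. *)
Lemma lnGamma_slope_ge (a b : R) : 1 < a -> a <= b ->
  (b - a) * ln (a - 1) <= lnGamma b - lnGamma a.
Proof.
  intros Ha [Hab| <-]; [|lra].
  pose proof (lnGamma_chords (a - 1) a b ltac:(lra) ltac:(lra) Hab) as H.
  pose proof (lnGamma_succ (a - 1) ltac:(lra)) as E.
  replace (a - 1 + 1) with a in E by ring.
  rewrite E in H |- *. lra.
Qed.

Lemma ln_diff_le (u v : R) : 0 < u -> 0 < v -> ln v - ln u <= (v - u) / u.
Proof.
  intros Hu Hv. rewrite <- ln_div by easy.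
  replace ((v - u) / u) with (v / u - 1) by (field; lra).
  apply ln_le_sub1. now apply Rdiv_lt_0_compat.
Qed.

Lemma lnGamma_increment (s h : R) : 2 < s -> Rabs h < 1 ->
  Rabs (lnGamma (s + h) - lnGamma s - h * ln s) <= 2 / (s - 2) * Rabs h.
Proof.
  intros Hs Hh. apply Rabs_def2 in Hh.
  assert (Hinv : forall r x, 0 <= x <= 2 -> s - 2 <= r -> x / r <= 2 / (s - 2)).
  { intros r x Hx Hr. apply Rle_trans with (2 / r).
    - apply Rmult_le_compat_r; [left; apply Rinv_0_lt_compat |]; lra.
    - apply Rmult_le_compat_l; [lra|]. apply Rinv_le_contravar; lra. }
  destruct (Rle_lt_dec 0 h) as [H0|H0].
  - pose proof (lnGamma_slope_le s (s + h) ltac:(lra) ltac:(lra)) as U.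
    pose proof (lnGamma_slope_ge s (s + h) ltac:(lra) ltac:(lra)) as L.
    replace (s + h - s) with h in * by ring.
    rewrite (Rabs_pos_eq h) by easy.
    pose proof (ln_diff_le s (s + h) ltac:(lra) ltac:(lra)) as D1.
    pose proof (ln_diff_le (s - 1) s ltac:(lra) ltac:(lra)) as D2.
    replace (s + h - s) with h in D1 by ring.
    replace (s - (s - 1)) with 1 in D2 by ring.
    pose proof (Hinv s h ltac:(lra) ltac:(lra)).
    pose proof (Hinv (s - 1) 1 ltac:(lra) ltac:(lra)).
    apply Rabs_le. split; nra.
  - pose proof (lnGamma_slope_le (s + h) s ltac:(lra) ltac:(lra)) as U.
    pose proof (lnGamma_slope_ge (s + h) s ltac:(lra) ltac:(lra)) as L.
    replace (s - (s + h)) with (- h) in * by ring.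
    rewrite (Rabs_left h) by easy.
    pose proof (ln_diff_le (s + h - 1) s ltac:(lra) ltac:(lra)) as D2.
    replace (s - (s + h - 1)) with (1 - h) in D2 by ring.
    pose proof (Hinv (s + h - 1) (1 - h) ltac:(lra) ltac:(lra)).
    pose proof (Hinv s 0 ltac:(lra) ltac:(lra)).
    unfold Rdiv in H1 at 1. rewrite Rmult_0_l in H1.
    apply Rabs_le. split; nra.
Qed.

(** [Lim_seq] is a total operator, so the convergence of the sequence that
    defines the constant has to be established: it decreases and is bounded
    below by 0, both by comparing ln (n + 1) - ln n with 1 / n and
    1 / (n + 1). *)
Lemma EulerGamma_lim :
  is_lim_seq (fun n => sum_f_R0 (fun k => / INR (S k)) n - ln (INR (S n))) EulerGamma.
Proof.
  apply Lim_seq_correct'. apply ex_finite_lim_seq_decr with 0.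
  - intros n. rewrite tech5.
    assert (Hp : 0 < INR (S n)) by (apply lt_0_INR; lia).
    assert (Hq : 0 < INR (S (S n))) by (apply lt_0_INR; lia).
    pose proof (ln_diff_le (INR (S (S n))) (INR (S n)) Hq Hp) as H.
    replace ((INR (S n) - INR (S (S n))) / INR (S (S n))) with (- / INR (S (S n))) in H
      by (rewrite (S_INR (S n)) in *; field; lra).
    lra.
  - assert (H : forall n, ln (INR (S (S n))) <= sum_f_R0 (fun k => / INR (S k)) n).
    { induction n as [|n IH].
      - pose proof (ln_diff_le 1 2 ltac:(lra) ltac:(lra)). rewrite ln_1 in H.
        simpl. replace (1 + 1) with 2 by ring. lra.
      - rewrite tech5.
        assert (Hp : 0 < INR (S (S n))) by (apply lt_0_INR; lia).
        assert (Hq : 0 < INR (S (S (S n)))) by (apply lt_0_INR; lia).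
        pose proof (ln_diff_le _ _ Hp Hq) as H.
        replace ((INR (S (S (S n))) - INR (S (S n))) / INR (S (S n)))
          with (/ INR (S (S n))) in H
          by (rewrite (S_INR (S (S n))) in *; field; lra).
        lra. }
    intros n. specialize (H n).
    assert (ln (INR (S n)) <= ln (INR (S (S n)))).
    { apply ln_le; [apply lt_0_INR; lia | apply le_INR; lia]. }
    lra.
Qed.

Lemma lnGamma_shift (n : nat) (h : R) : -1 < h ->
  lnGamma (INR (S (S n)) + h)
  = lnGamma (1 + h) + sum_f_R0 (fun k => ln (INR (S k) + h)) n.
Proof.
  intros Hh. induction n as [|n IH].
  - simpl. replace (1 + 1 + h) with (1 + h + 1) by ring. rewrite lnGamma_succ by lra.
    reflexivity.
  - rewrite tech5, <- Rplus_assoc, <- IH, (S_INR (S (S n))).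
    replace (INR (S (S n)) + 1 + h) with (INR (S (S n)) + h + 1) by ring.
    apply lnGamma_succ.
    rewrite S_INR. pose proof (pos_INR (S n)). lra.
Qed.

Lemma sum_ln_derive (n : nat) :
  is_derive (fun h => sum_f_R0 (fun k => ln (INR (S k) + h)) n) 0
    (sum_f_R0 (fun k => / INR (S k)) n).
Proof.
  assert (Hk : forall k, is_derive (fun h => ln (INR (S k) + h)) 0 (/ INR (S k))).
  { intros k. assert (0 < INR (S k)) by (apply lt_0_INR; lia).
    revert H. generalize (INR (S k)). intros c Hc.
    auto_derive; [lra|]. field. lra. }
  induction n as [|n IH].
  - apply Hk.
  - simpl sum_f_R0 at 2.
    apply is_derive_ext with (f := fun h => sum_f_R0 (fun k => ln (INR (S k) + h)) n
                                     + ln (INR (S (S n)) + h)).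
    { intros t. reflexivity. }
    apply (is_derive_plus (V := R_NormedModule)); [exact IH | apply Hk].
Qed.

(** By [lnGamma_shift], the increment of ln Gamma from 1 to 1 + h is the
    increment at n + 2, which is h ln (n + 2) up to 2 |h| / n, minus a finite
    sum of logarithms whose derivative at h = 0 is the harmonic number. For
    large n the difference ln (n + 2) - H_(n + 1) is close to - EulerGamma; n is
    chosen first, and h small afterwards. *)
Lemma lnGamma_derive_1 : is_derive lnGamma 1 (- EulerGamma).
Proof.
  apply is_derive_little_o. intros eps Heps.
  pose proof (proj2 (is_lim_seq_spec _ _) EulerGamma_lim) as Hlim.
  destruct (Hlim (mkposreal (eps / 4) ltac:(lra))) as [N HN]. cbn [pos] in HN.
  (* n > 8 / eps makes both 2 / n and ln (n + 2) - ln (n + 1) at most eps / 4. *)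
  destruct (nfloor_ex (8 / eps)) as [m Hm].
  { left. apply Rdiv_lt_0_compat; lra. }
  set (n := (N + S m)%nat).
  specialize (HN n ltac:(unfold n; lia)).
  assert (Hn : 8 / eps < INR n).
  { unfold n. rewrite plus_INR, S_INR. pose proof (pos_INR N). lra. }
  assert (Hn8 : 8 < eps * INR n).
  { apply (Rmult_lt_compat_l eps) in Hn; [|lra].
    replace (eps * (8 / eps)) with 8 in Hn by (field; lra). lra. }
  assert (Hn0 : 0 < INR n) by nra.
  destruct (proj1 (is_derive_little_o _ _ _) (sum_ln_derive n) (eps / 4) ltac:(lra))
    as (d & Hd & Hder).
  exists (Rmin d 1). split; [apply Rmin_glb_lt; lra|].
  intros t Ht. set (h := t - 1) in *.
  assert (Hh1 : Rabs h < 1) by (eapply Rlt_le_trans; [exact Ht | apply Rmin_r]).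
  assert (Hhd : Rabs h < d) by (eapply Rlt_le_trans; [exact Ht | apply Rmin_l]).
  specialize (Hder h). rewrite Rminus_0_r in Hder. specialize (Hder Hhd).
  replace t with (1 + h) by (unfold h; ring). rewrite lnGamma_1.
  assert (Hb := Rabs_def2 _ _ Hh1).
  pose proof (lnGamma_shift n h ltac:(lra)) as S1.
  pose proof (lnGamma_shift n 0 ltac:(lra)) as S0.
  rewrite !Rplus_0_r, lnGamma_1, Rplus_0_l in S0.
  set (Q := fun h => sum_f_R0 (fun k => ln (INR (S k) + h)) n) in *.
  change (sum_f_R0 (fun k => ln (INR (S k) + h)) n) with (Q h) in *.
  change (sum_f_R0 (fun k => ln (INR (S k) + 0)) n) with (Q 0) in *.
  set (H := sum_f_R0 (fun k => / INR (S k)) n) in *.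
  assert (E2 : INR (S (S n)) - 2 = INR n) by (rewrite !S_INR; ring).
  pose proof (lnGamma_increment (INR (S (S n))) h ltac:(lra) Hh1) as Hinc.
  rewrite E2 in Hinc.
  assert (HL : Rabs (ln (INR (S (S n))) - ln (INR (S n))) <= eps / 4).
  { assert (Hp : 0 < INR (S n)) by (apply lt_0_INR; lia).
    assert (Hq : 0 < INR (S (S n))) by (apply lt_0_INR; lia).
    pose proof (ln_diff_le _ _ Hp Hq) as D.
    replace ((INR (S (S n)) - INR (S n)) / INR (S n)) with (/ INR (S n)) in D
      by (rewrite (S_INR (S n)) in *; field; lra).
    assert (ln (INR (S n)) <= ln (INR (S (S n)))).
    { apply ln_le; [easy | apply le_INR; lia]. }
    rewrite Rabs_pos_eq by lra. apply Rle_trans with (1 := D).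
    apply Rmult_le_reg_l with (INR (S n)); [easy|]. rewrite Rinv_r by lra.
    rewrite S_INR. nra. }
  assert (Hi : 2 / INR n <= eps / 4).
  { apply Rmult_le_reg_l with (INR n); [easy|].
    replace (INR n * (2 / INR n)) with 2 by (field; lra). nra. }
  replace (lnGamma (1 + h) - 0 - - EulerGamma * h) with
    ((lnGamma (INR (S (S n)) + h) - lnGamma (INR (S (S n))) - h * ln (INR (S (S n))))
     - (Q h - Q 0 - H * h)
     + h * (ln (INR (S (S n))) - ln (INR (S n)))
     - h * (H - ln (INR (S n)) - EulerGamma)).
  2:{ rewrite S1, S0. unfold Q.
      replace (sum_f_R0 (fun k => ln (INR (S k) + 0)) n)
        with (sum_f_R0 (fun k => ln (INR (S k))) n); [ring|].
      apply sum_eq. intros. f_equal. ring. }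
  assert (Hp := Rabs_pos h).
  eapply Rle_trans; [apply Rabs_triang|]. rewrite Rabs_Ropp, Rabs_mult.
  eapply Rle_trans; [apply Rplus_le_compat_r, Rabs_triang|]. rewrite Rabs_mult.
  eapply Rle_trans; [apply Rplus_le_compat_r, Rplus_le_compat_r, Rabs_triang|].
  rewrite Rabs_Ropp.
  assert (Rabs h * Rabs (H - ln (INR (S n)) - EulerGamma) <= Rabs h * (eps / 4))
    by (apply Rmult_le_compat_l; lra).
  assert (Rabs h * Rabs (ln (INR (S (S n))) - ln (INR (S n))) <= Rabs h * (eps / 4))
    by (apply Rmult_le_compat_l; lra).
  assert (2 / INR n * Rabs h <= eps / 4 * Rabs h) by (apply Rmult_le_compat_r; lra).
  lra.
Qed.

(** * The reciprocal Gamma function at the integers *)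

(** The shift in the definition of [rGamma] is 0 for s > 0 and 1 for
    -1 < s <= 0; no other value occurs in what follows. *)
Lemma rGamma_of_pos (s : R) : 0 < s -> rGamma s = / Gamma_int s.
Proof.
  intros Hs. unfold rGamma. destruct (archimed (- s)) as [_ H].
  assert (Hz : (up (- s) < 1)%Z) by (apply lt_IZR; lra).
  replace (Z.to_nat (up (- s))) with 0%nat by lia.
  simpl. rewrite Rplus_0_r. unfold Rdiv. ring.
Qed.

Lemma rGamma_exp (s : R) : 0 < s -> rGamma s = exp (- lnGamma s).
Proof.
  intros Hs. now rewrite rGamma_of_pos, exp_Ropp, exp_lnGamma.
Qed.

Lemma rGamma_rec (s : R) : -1 < s -> rGamma s = s * rGamma (s + 1).
Proof.
  intros Hs. destruct (Rlt_le_dec 0 s) as [H0|H0].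
  - rewrite !rGamma_of_pos, Gamma_int_succ by lra.
    field. split; [|lra]. apply Rgt_not_eq, Gamma_int_pos, H0.
  - rewrite (rGamma_of_pos (s + 1)) by lra. unfold rGamma.
    rewrite <- (up_tech (- s) 0) by (simpl; lra).
    simpl. rewrite Rplus_0_r. unfold Rdiv. ring.
Qed.

Lemma rGamma_1 : rGamma 1 = 1.
Proof. rewrite rGamma_of_pos, Gamma_int_1 by lra. apply Rinv_1. Qed.

Lemma rGamma_nat (n : nat) : rGamma (INR n + 1) = / INR (fact n).
Proof.
  induction n as [|n IH].
  - simpl. rewrite Rplus_0_l, rGamma_1. field.
  - pose proof (pos_INR n).
    pose proof (rGamma_rec (INR n + 1) ltac:(lra)) as E. rewrite IH in E.
    rewrite S_INR, fact_simpl, mult_INR, S_INR.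
    pose proof (INR_fact_neq_0 n).
    apply Rmult_eq_reg_l with (INR n + 1); [|lra]. rewrite <- E. field. lra.
Qed.

Lemma rGamma_derive_1 : is_derive rGamma 1 EulerGamma.
Proof.
  apply is_derive_ext_loc with (fun s => exp (- lnGamma s)).
  - exists (mkposreal 1 Rlt_0_1). intros y Hy.
    apply Rabs_def2 in Hy. unfold minus, plus, opp in Hy; simpl in Hy.
    symmetry. apply rGamma_exp. lra.
  - replace EulerGamma with (scal (- - EulerGamma) (exp (- lnGamma 1))).
    + apply (is_derive_comp (V := R_NormedModule) exp (fun s => - lnGamma s)).
      * apply is_derive_exp.
      * apply (is_derive_opp (V := R_NormedModule)). apply lnGamma_derive_1.
    + rewrite lnGamma_1, Ropp_0, exp_0. unfold scal; simpl; unfold mult; simpl. ring.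
Qed.

Lemma rGamma_derive_pred (s d : R) : -1 < s -> is_derive rGamma (s + 1) d ->
  is_derive rGamma s (rGamma (s + 1) + s * d).
Proof.
  intros Hs Hd.
  apply is_derive_ext_loc with (fun t => t * rGamma (t + 1)).
  - assert (H : 0 < s + 1) by lra. exists (mkposreal _ H). intros y Hy.
    apply Rabs_def2 in Hy. unfold minus, plus, opp in Hy; simpl in Hy.
    symmetry. apply rGamma_rec. lra.
  - replace (rGamma (s + 1) + s * d) with (1 * rGamma (s + 1) + s * (1 * d)) by ring.
    apply (is_derive_mult (fun t => t) (fun t => rGamma (t + 1))).
    + apply (is_derive_id (K := R_AbsRing)).
    + apply (is_derive_comp (V := R_NormedModule) rGamma (fun t => t + 1)); [exact Hd|].
      auto_derive; trivial.
    + intros; apply Rmult_comm.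
Qed.

Lemma rGamma_ex_derive_succ (s : R) : 0 < s -> ex_derive rGamma s ->
  ex_derive rGamma (s + 1).
Proof.
  intros Hs Hd.
  assert (E : forall t : R, 1 < t -> rGamma (t - 1) / (t - 1) = rGamma t).
  { intros t Ht. rewrite (rGamma_rec (t - 1)) by lra.
    replace (t - 1 + 1) with t by ring. field. lra. }
  apply ex_derive_ext_loc with (fun t => rGamma (t - 1) / (t - 1)).
  - exists (mkposreal s Hs). intros y Hy.
    apply Rabs_def2 in Hy. unfold minus, plus, opp in Hy; simpl in Hy.
    apply E. lra.
  - apply (ex_derive_div (fun t => rGamma (t - 1)) (fun t => t - 1)).
    + apply (ex_derive_comp (V := R_NormedModule) rGamma (fun t => t - 1)).
      * assert (E1 : s + 1 - 1 = s) by ring. rewrite E1. exact Hd.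
      * auto_derive; trivial.
    + auto_derive; trivial.
    + lra.
Qed.

Definition rGamma' (n : nat) : R := Derive rGamma (INR n).

Lemma rGamma_derive_nat (n : nat) : is_derive rGamma (INR n) (rGamma' n).
Proof.
  apply Derive_correct.
  assert (H : forall m, ex_derive rGamma (INR (S m))).
  { induction m as [|m IH].
    - eexists. apply rGamma_derive_1.
    - rewrite S_INR. apply rGamma_ex_derive_succ; [apply lt_0_INR; lia | exact IH]. }
  destruct n as [|n]; [|apply H].
  eexists. apply rGamma_derive_pred; [simpl; lra|]. rewrite <- S_INR.
  apply Derive_correct, H.
Qed.

Lemma rGamma'_rec (n : nat) :
  rGamma' n = rGamma (INR n + 1) + INR n * rGamma' (S n).
Proof.
  apply is_derive_unique. pose proof (pos_INR n).
  apply rGamma_derive_pred; [lra|]. rewrite <- S_INR. apply rGamma_derive_nat.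
Qed.

Lemma rGamma'_2 : rGamma' 2 = EulerGamma - 1.
Proof.
  assert (E : rGamma' 1 = EulerGamma) by apply is_derive_unique, rGamma_derive_1.
  rewrite rGamma'_rec, rGamma_nat in E. simpl in E. lra.
Qed.

Lemma le_pow2 (k : nat) : INR k + 1 <= 2 ^ k.
Proof.
  induction k as [|k IH]; [simpl; lra|]. rewrite S_INR. simpl.
  pose proof (pos_INR k). lra.
Qed.

(** On [2, oo) ln Gamma is nonnegative and increasing, so passing to
    exp (- ln Gamma) does not increase differences, and the chord slopes of
    ln Gamma up to 2 k + 4 are at most ln (2 k + 4) <= 2 k + 3 <= 3 * 2^k. The
    range is wide enough for both families of series below, and a geometric
    bound keeps the dominating series exponential. *)
Lemma rGamma_lipschitz (k : nat) (a b : R) :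
  2 <= a -> a <= 2 * INR k + 4 -> 2 <= b -> b <= 2 * INR k + 4 ->
  Rabs (rGamma b - rGamma a) <= 3 * 2 ^ k * Rabs (b - a).
Proof.
  assert (H : forall a b, 2 <= a -> a <= b -> b <= 2 * INR k + 4 ->
            Rabs (rGamma b - rGamma a) <= 3 * 2 ^ k * Rabs (b - a)).
  { clear a b. intros a b Ha Hab Hb.
    assert (Hln : forall t, 1 <= t -> 0 <= ln t).
    { intros t Ht. rewrite <- ln_1. apply ln_le; lra. }
    assert (H2 : 0 <= lnGamma a).
    { pose proof (lnGamma_slope_ge 2 a ltac:(lra) Ha) as H.
      rewrite lnGamma_2 in H. pose proof (Hln (2 - 1) ltac:(lra)). nra. }
    pose proof (lnGamma_slope_ge a b ltac:(lra) Hab) as L.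
    pose proof (lnGamma_slope_le a b ltac:(lra) Hab) as U.
    pose proof (Hln (a - 1) ltac:(lra)).
    pose proof (ln_le_sub1 b ltac:(lra)).
    pose proof (le_pow2 k). pose proof (pos_INR k).
    rewrite !rGamma_exp by lra.
    replace (- lnGamma b) with (- lnGamma a + - (lnGamma b - lnGamma a)) by ring.
    rewrite exp_plus.
    set (D := lnGamma b - lnGamma a) in *.
    assert (0 <= D) by nra.
    pose proof (exp_ineq1_le (- D)).
    assert (exp (- D) <= 1) by (rewrite <- exp_0; apply exp_le_mono; lra).
    assert (exp (- lnGamma a) <= 1) by (rewrite <- exp_0; apply exp_le_mono; lra).
    pose proof (exp_pos (- lnGamma a)).
    rewrite (Rabs_pos_eq (b - a)) by lra.
    rewrite Rabs_left1 by nra.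
    apply Rle_trans with D; [nra|].
    apply Rle_trans with ((b - a) * ln b); [exact U|].
    rewrite Rmult_comm. apply Rmult_le_compat_r; lra. }
  intros Ha1 Ha2 Hb1 Hb2. destruct (Rle_lt_dec a b) as [Hab|Hab].
  - now apply H.
  - rewrite Rabs_minus_sym, (Rabs_minus_sym b a). apply H; lra.
Qed.

(** * Termwise differentiation *)

Lemma sum_little_o (r : nat -> R -> R) (a : R) :
  (forall n eps, 0 < eps -> exists d, 0 < d /\
     forall t, Rabs (t - a) < d -> Rabs (r n t) <= eps * Rabs (t - a)) ->
  forall n eps, 0 < eps -> exists d, 0 < d /\
     forall t, Rabs (t - a) < d ->
       Rabs (sum_f_R0 (fun k => r k t) n) <= eps * Rabs (t - a).
Proof.
  intros H n. induction n as [|n IH]; intros eps Heps; [now apply H|].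
  destruct (IH (eps / 2)) as (d1 & Hd1 & H1); [lra|].
  destruct (H (S n) (eps / 2)) as (d2 & Hd2 & H2); [lra|].
  exists (Rmin d1 d2). split; [now apply Rmin_glb_lt|].
  intros t Ht. rewrite tech5.
  specialize (H1 t (Rlt_le_trans _ _ _ Ht (Rmin_l _ _))).
  specialize (H2 t (Rlt_le_trans _ _ _ Ht (Rmin_r _ _))).
  eapply Rle_trans; [apply Rabs_triang|]. lra.
Qed.

Lemma series_tail_small (M : nat -> R) (eps : R) :
  ex_series M -> 0 < eps ->
  exists n, Rabs (Series (fun k => M (S n + k)%nat)) < eps.
Proof.
  intros HM Heps.
  assert (Hl : is_lim_seq (sum_n M) (Series M)) by now apply Series_correct.
  apply is_lim_seq_spec in Hl. destruct (Hl (mkposreal eps Heps)) as [n Hn].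
  exists n. specialize (Hn n (le_n n)). cbn [pos] in Hn.
  rewrite sum_n_Reals, (Series_incr_n M (S n)) in Hn by (easy || lia).
  simpl pred in Hn. rewrite <- Rabs_Ropp.
  match goal with |- Rabs ?u < _ => match type of Hn with Rabs ?v < _ =>
    replace u with v by ring end end.
  exact Hn.
Qed.

(** Dominated convergence for difference quotients: the Lipschitz constants
    dominate them, so the tail of the series is uniformly small, and the
    remaining finite sum is differentiated term by term. *)
Lemma Series_derive_of_lipschitz (u : nat -> R -> R) (u' M : nat -> R) (a delta : R) :
  0 < delta ->
  (forall n, is_derive (u n) a (u' n)) ->
  (forall n t, Rabs (t - a) < delta -> Rabs (u n t - u n a) <= M n * Rabs (t - a)) ->
  ex_series M -> ex_series (fun n => u n a) ->
  ex_series u' /\ is_derive (fun t => Series (fun n => u n t)) a (Series u').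
Proof.
  intros Hd Hu HL HM Ha.
  assert (Hu' : forall n, Rabs (u' n) <= M n).
  { intros n. apply le_epsilon. intros eps Heps.
    destruct (proj1 (is_derive_little_o _ _ _) (Hu n) eps Heps) as (d & Hd0 & H).
    set (h := Rmin d delta / 2).
    assert (0 < Rmin d delta) by now apply Rmin_glb_lt.
    pose proof (Rmin_l d delta). pose proof (Rmin_r d delta).
    assert (Hh : Rabs (a + h - a) = h).
    { replace (a + h - a) with h by ring. apply Rabs_pos_eq. unfold h; lra. }
    specialize (H (a + h)). specialize (HL n (a + h)). rewrite Hh in *.
    specialize (H ltac:(unfold h; lra)). specialize (HL ltac:(unfold h; lra)).
    apply Rmult_le_reg_r with h; [unfold h; lra|].
    replace (Rabs (u' n) * h) with (Rabs (u' n * (a + h - a)))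
      by (rewrite Rabs_mult, Hh; ring).
    replace (u' n * (a + h - a)) with
      ((u n (a + h) - u n a) - (u n (a + h) - u n a - u' n * (a + h - a))) by ring.
    eapply Rle_trans; [apply Rabs_triang|]. rewrite Rabs_Ropp. lra. }
  assert (Hex' : ex_series u').
  { apply (ex_series_le (V := R_CompleteNormedModule) u' M); [exact Hu' | exact HM]. }
  split; [exact Hex'|].
  apply is_derive_little_o. intros eps Heps.
  set (r := fun n t => u n t - u n a - u' n * (t - a)).
  assert (Hr : forall n t, Rabs (t - a) < delta ->
            Rabs (r n t) <= 2 * Rabs (t - a) * M n).
  { intros n t Ht. specialize (HL n t Ht). specialize (Hu' n). unfold r, Rminus at 1.
    eapply Rle_trans; [apply Rabs_triang|]. rewrite Rabs_Ropp, Rabs_mult.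
    pose proof (Rabs_pos (t - a)). nra. }
  destruct (series_tail_small M (eps / 4) HM ltac:(lra)) as [P HP].
  destruct (sum_little_o r a) with (n := P) (eps := eps / 2) as (d & Hd0 & Hsum).
  { intros n e He. apply (proj1 (is_derive_little_o _ _ _) (Hu n) e He). }
  { lra. }
  exists (Rmin d delta). split; [now apply Rmin_glb_lt|].
  intros t Ht.
  pose proof (Rlt_le_trans _ _ _ Ht (Rmin_l _ _)) as Ht1.
  pose proof (Rlt_le_trans _ _ _ Ht (Rmin_r _ _)) as Ht2.
  specialize (Hsum t Ht1).
  assert (Hexr : ex_series (fun n => r n t)).
  { apply (ex_series_le (V := R_CompleteNormedModule) _ (fun n => 2 * Rabs (t - a) * M n)).
    - intros n. now apply Hr.
    - apply (ex_series_scal (2 * Rabs (t - a)) M HM). }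
  assert (Hexd : ex_series (fun n => u' n * (t - a))).
  { apply (ex_series_scal_r (t - a) u'). exact Hex'. }
  assert (Hext : ex_series (fun n => u n t)).
  { apply ex_series_ext with (fun n => r n t + (u n a + u' n * (t - a))).
    { intros n. unfold r. simpl. ring. }
    apply (ex_series_plus (V := R_NormedModule)); [exact Hexr|].
    now apply (ex_series_plus (V := R_NormedModule)). }
  replace (Series (fun n => u n t) - Series (fun n => u n a) - Series u' * (t - a))
    with (Series (fun n => r n t)).
  2:{ unfold r. rewrite <- Series_scal_r, <- !Series_minus; try easy.
      apply (ex_series_minus (V := R_NormedModule)); easy. }
  rewrite (Series_incr_n _ (S P)) by (easy || lia). simpl pred.
  eapply Rle_trans; [apply Rabs_triang|].
  assert (HexM : ex_series (fun k => M (S P + k)%nat)).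
  { now apply (ex_series_incr_n (V := R_NormedModule) M (S P)). }
  assert (Htail : Rabs (Series (fun k => r (S P + k)%nat t))
                  <= 2 * Rabs (t - a) * Series (fun k => M (S P + k)%nat)).
  { rewrite <- Series_scal_l.
    assert (Hb : forall k, 0 <= Rabs (r (S P + k)%nat t) <= 2 * Rabs (t - a) * M (S P + k)%nat).
    { intros k. split; [apply Rabs_pos | now apply Hr]. }
    assert (Hs : ex_series (fun k => 2 * Rabs (t - a) * M (S P + k)%nat))
      by now apply (ex_series_scal (2 * Rabs (t - a)) (fun k => M (S P + k)%nat)).
    eapply Rle_trans; [apply Series_Rabs | now apply Series_le].
    apply (ex_series_le (V := R_CompleteNormedModule) _
             (fun k => 2 * Rabs (t - a) * M (S P + k)%nat)); [|exact Hs].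
    intros k. eapply Rle_trans; [right; apply Rabs_Rabsolu | apply Hb]. }
  pose proof (Rle_abs (Series (fun k => M (S P + k)%nat))).
  pose proof (Rabs_pos (t - a)). nra.
Qed.

(** Differentiability at a makes each of the first N terms Lipschitz in some
    neighbourhood of a, so a common bound is asked for from N on. This admits
    the Bessel series, whose first terms evaluate 1 / Gamma outside the range of
    [rGamma_lipschitz]. *)
Lemma is_derive_Series (N : nat) (u : nat -> R -> R) (u' M : nat -> R) (a delta : R) :
  0 < delta ->
  (forall n, is_derive (u n) a (u' n)) ->
  (forall n t, (N <= n)%nat -> Rabs (t - a) < delta ->
     Rabs (u n t - u n a) <= M n * Rabs (t - a)) ->
  ex_series M -> ex_series (fun n => u n a) ->
  ex_series u' /\ is_derive (fun t => Series (fun n => u n t)) a (Series u').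
Proof.
  revert M delta. induction N as [|N IH]; intros M delta Hd Hu HL HM Ha.
  - apply (Series_derive_of_lipschitz u u' M a delta); try easy.
    intros n t. apply HL. lia.
  - destruct (proj1 (is_derive_little_o _ _ _) (Hu N) 1 Rlt_0_1) as (d & Hd0 & H).
    apply (IH (fun n => if Nat.eqb n N then Rabs (u' N) + 1 else M n) (Rmin d delta)).
    + now apply Rmin_glb_lt.
    + exact Hu.
    + intros n t Hn Ht.
      pose proof (Rlt_le_trans _ _ _ Ht (Rmin_l _ _)) as Ht1.
      pose proof (Rlt_le_trans _ _ _ Ht (Rmin_r _ _)) as Ht2.
      destruct (Nat.eqb_spec n N) as [->|Hne]; [|apply HL; [lia|easy]].
      specialize (H t Ht1).
      replace (u N t - u N a) with ((u N t - u N a - u' N * (t - a)) + u' N * (t - a))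
        by ring.
      eapply Rle_trans; [apply Rabs_triang|]. rewrite Rabs_mult. lra.
    + apply (ex_series_incr_n (V := R_NormedModule) _ (S N)).
      apply ex_series_ext with (fun k => M (S N + k)%nat).
      * intros k. destruct (Nat.eqb_spec (S N + k) N); [lia | reflexivity].
      * now apply (ex_series_incr_n (V := R_NormedModule) M (S N)).
    + exact Ha.
Qed.

Lemma ex_series_exp (y K : R) : ex_series (fun n => K * (y ^ n / INR (fact n))).
Proof.
  apply (ex_series_scal K (fun n => y ^ n / INR (fact n))).
  exists (exp y). pose proof (is_exp_Reals y) as H.
  eapply is_series_ext; [|exact H].
  intros n. simpl. rewrite pow_n_pow. unfold scal; simpl; unfold mult; simpl.
  reflexivity.
Qed.

Lemma ex_series_exp_bounded (y K : R) (c : nat -> R) :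
  (forall n, Rabs (c n) <= K) -> ex_series (fun n => y ^ n / INR (fact n) * c n).
Proof.
  intros Hc.
  apply (ex_series_le (V := R_CompleteNormedModule) _
           (fun n => K * (Rabs y ^ n / INR (fact n)))); [|apply ex_series_exp].
  intros n. change (Rabs (y ^ n / INR (fact n) * c n)
                    <= K * (Rabs y ^ n / INR (fact n))).
  pose proof (INR_fact_lt_0 n) as Hf.
  unfold Rdiv. rewrite !Rabs_mult, Rabs_inv, <- RPow_abs, (Rabs_pos_eq (INR _)) by lra.
  rewrite (Rmult_comm K). apply Rmult_le_compat_l; [|apply Hc].
  apply Rmult_le_pos; [apply pow_le, Rabs_pos | left; now apply Rinv_0_lt_compat].
Qed.

Lemma rGamma_nat_bounded (n : nat) : Rabs (rGamma (INR n)) <= 1.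
Proof.
  destruct n as [|n].
  - rewrite rGamma_rec by (simpl; lra). simpl. rewrite Rmult_0_l, Rabs_R0. lra.
  - rewrite S_INR, rGamma_nat. pose proof (INR_fact_lt_0 n).
    rewrite Rabs_pos_eq by (left; now apply Rinv_0_lt_compat).
    rewrite <- Rinv_1. apply Rinv_le_contravar; [lra|].
    apply (le_INR 1), lt_O_fact.
Qed.

Lemma pow_fact_Rabs (x : R) (k : nat) :
  Rabs (x ^ k / INR (fact k)) * (3 * 2 ^ k) = 3 * ((2 * Rabs x) ^ k / INR (fact k)).
Proof.
  pose proof (INR_fact_lt_0 k) as Hf.
  unfold Rdiv. rewrite Rabs_mult, Rabs_inv, <- RPow_abs, (Rabs_pos_eq (INR _)) by lra.
  rewrite Rpow_mult_distr. ring.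
Qed.

Lemma affine_derive (c l a d : R) (f : R -> R) (y : R) :
  is_derive f (a * l + d) y -> is_derive (fun t => c * f (t * l + d)) a (c * (l * y)).
Proof.
  intros H. apply (is_derive_scal (fun t => f (t * l + d))).
  apply (is_derive_comp (V := R_NormedModule) f (fun t => t * l + d)); [exact H|].
  auto_derive; [trivial | ring].
Qed.

(** The real power series in x = (z / 2)^2 left of the modified Bessel function
    I_nu (z) after removing the factor (z / 2)^nu. *)
Definition besselSeries (x nu : R) : R :=
  Series (fun k => x ^ k / INR (fact k) * rGamma (INR k + nu + 1)).

(** The derivative with respect to the order, at an integer order nu = m - 1. *)
Lemma besselSeries_derive (x nu : R) (m : nat) : INR m = nu + 1 ->
  ex_series (fun k => x ^ k / INR (fact k) * rGamma' (k + m)) /\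
  is_derive (besselSeries x) nu
    (Series (fun k => x ^ k / INR (fact k) * rGamma' (k + m))).
Proof.
  intros Hm.
  assert (Ek : forall k, INR k + nu + 1 = INR (k + m)).
  { intros k. rewrite plus_INR, Hm. ring. }
  (* From k = m + 3 on, k + m +- 1/2 lies in [2, 2 k + 4]. *)
  apply (is_derive_Series (m + 3)
    (fun k t => x ^ k / INR (fact k) * rGamma (INR k + t + 1)) _
    (fun k => 3 * ((2 * Rabs x) ^ k / INR (fact k))) nu (1 / 2)).
  - lra.
  - intros k. apply is_derive_ext with
      (fun t => x ^ k / INR (fact k) * rGamma (t * 1 + (INR k + 1))).
    { intros t. do 2 f_equal. ring. }
    rewrite <- (Rmult_1_l (rGamma' (k + m))). apply affine_derive.
    replace (nu * 1 + (INR k + 1)) with (INR (k + m)) by (rewrite <- Ek; ring).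
    apply rGamma_derive_nat.
  - intros k t Hk Ht. apply Rabs_def2 in Ht.
    rewrite <- Rmult_minus_distr_l, Rabs_mult, <- pow_fact_Rabs, Rmult_assoc.
    apply Rmult_le_compat_l; [apply Rabs_pos|].
    apply le_INR in Hk. rewrite plus_INR in Hk. simpl in Hk.
    pose proof (pos_INR m).
    replace (t - nu) with (INR k + t + 1 - (INR k + nu + 1)) by ring.
    apply rGamma_lipschitz; lra.
  - apply ex_series_exp.
  - apply ex_series_exp_bounded with 1. intros k. rewrite Ek. apply rGamma_nat_bounded.
Qed.

(** The factor k produced by the inner derivative of alpha k + 2 cancels the k
    in the denominator of the series. *)
Lemma Wi_derive (x : R) :
  is_derive (fun alpha => Wi alpha 2 x) 1
    (Series (fun n => x ^ S n / INR (fact (S n)) * rGamma' (S n + 2))).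
Proof.
  unfold Wi. cbv zeta.
  assert (Ek : forall n, 1 * INR (S n) + 2 = INR (S n + 2)).
  { intros n. rewrite plus_INR. simpl (INR 2). ring. }
  apply (is_derive_Series 0
    (fun n alpha => x ^ S n / (INR (S n) * INR (fact (S n)))
                    * rGamma (alpha * INR (S n) + 2)) _
    (fun n => 3 * ((2 * Rabs x) ^ S n / INR (fact (S n)))) 1 (1 / 2)).
  - lra.
  - intros n.
    assert (Hn : 0 < INR (S n)) by (apply lt_0_INR; lia).
    pose proof (INR_fact_lt_0 (S n)).
    replace (x ^ S n / INR (fact (S n)) * rGamma' (S n + 2)) with
      (x ^ S n / (INR (S n) * INR (fact (S n))) * (INR (S n) * rGamma' (S n + 2)))
      by (field; lra).
    apply affine_derive. rewrite Ek. apply rGamma_derive_nat.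
  - intros n t _ Ht. apply Rabs_def2 in Ht.
    assert (Hn : 1 <= INR (S n)) by (apply (le_INR 1); lia).
    pose proof (INR_fact_lt_0 (S n)).
    rewrite <- Rmult_minus_distr_l, Rabs_mult, <- pow_fact_Rabs.
    replace (Rabs (x ^ S n / INR (fact (S n)))) with
      (Rabs (x ^ S n / (INR (S n) * INR (fact (S n)))) * INR (S n)).
    2:{ rewrite <- (Rabs_pos_eq (INR (S n))) at 2 by lra. rewrite <- Rabs_mult.
        f_equal. field. lra. }
    rewrite !Rmult_assoc. apply Rmult_le_compat_l; [apply Rabs_pos|].
    eapply Rle_trans; [apply (rGamma_lipschitz (S n)); nra|].
    replace (t * INR (S n) + 2 - (1 * INR (S n) + 2)) with (INR (S n) * (t - 1)) by ring.
    rewrite Rabs_mult, (Rabs_pos_eq (INR (S n))) by lra. lra.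
  - apply (ex_series_incr_1 (fun k => 3 * ((2 * Rabs x) ^ k / INR (fact k)))).
    apply ex_series_exp.
  (* Split off x / k^2, with k = n + 1, to compare with the series of exp. *)
  - apply ex_series_ext with (fun n => x * (x ^ n / INR (fact n)
       * (rGamma (INR (S n + 2)) / (INR (S n) * INR (S n))))).
    { intros n. rewrite Ek, fact_simpl, mult_INR.
      match goal with |- ?u = ?v => change (@eq R u v) end.
      assert (Hn : 0 < INR (S n)) by (apply lt_0_INR; lia).
      pose proof (INR_fact_lt_0 n). simpl (x ^ S n). field. lra. }
    apply (ex_series_scal x
      (fun n => x ^ n / INR (fact n) * (rGamma (INR (S n + 2)) / (INR (S n) * INR (S n))))).
    apply ex_series_exp_bounded with 1. intros n.
    assert (Hn : 1 <= INR (S n)) by (apply (le_INR 1); lia).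
    assert (Hn2 : 1 <= INR (S n) * INR (S n)) by nra.
    unfold Rdiv. rewrite Rabs_mult, Rabs_inv, (Rabs_pos_eq (_ * _)) by lra.
    pose proof (rGamma_nat_bounded (S n + 2)).
    pose proof (Rabs_pos (rGamma (INR (S n + 2)))).
    assert (0 < / (INR (S n) * INR (S n)) <= 1).
    { split; [apply Rinv_0_lt_compat; lra|]. rewrite <- Rinv_1.
      apply Rinv_le_contravar; lra. }
    nra.
Qed.

(** Index shift k -> k + 1, using k / k! = 1 / (k - 1)!. Applied to a recurrence
    of the form c k = k c (k + 1), it produces the factor x in the relations
    between Bessel series of neighbouring orders. *)
Lemma Series_shift (x : R) (c : nat -> R) :
  Series (fun k => x ^ k / INR (fact k) * (INR k * c (S k)))
  = x * Series (fun k => x ^ k / INR (fact k) * c (k + 2)%nat).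
Proof.
  rewrite Series_incr_1_aux by (simpl; ring).
  rewrite <- Series_scal_l. apply Series_ext. intros k.
  replace (k + 2)%nat with (S (S k)) by lia.
  rewrite fact_simpl, mult_INR.
  assert (0 < INR (S k)) by (apply lt_0_INR; lia).
  pose proof (INR_fact_lt_0 k). simpl (x ^ S k). field. lra.
Qed.

(** The identity I_(-1) = I_1. *)
Lemma besselSeries_m1 (x : R) : besselSeries x (-1) = x * besselSeries x 1.
Proof.
  unfold besselSeries.
  transitivity (x * Series (fun k => x ^ k / INR (fact k) * rGamma (INR (k + 2)))).
  - rewrite <- (Series_shift x (fun k => rGamma (INR k))). apply Series_ext. intros k.
    f_equal. replace (INR k + -1 + 1) with (INR k) by ring.
    rewrite S_INR. apply rGamma_rec. pose proof (pos_INR k). lra.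
  - f_equal. apply Series_ext. intros k. do 2 f_equal.
    rewrite plus_INR. simpl. ring.
Qed.

(** The relation A = S 0 + x B between order derivatives at -1 and 1. *)
Lemma besselSeries'_m1 (x : R) :
  Series (fun k => x ^ k / INR (fact k) * rGamma' (k + 0)) - besselSeries x 0
  = x * Series (fun k => x ^ k / INR (fact k) * rGamma' (k + 2)).
Proof.
  destruct (besselSeries_derive x (-1) 0) as [H _]; [simpl; ring|].
  unfold besselSeries. rewrite <- Series_minus; [|exact H|].
  - rewrite <- (Series_shift x rGamma'). apply Series_ext. intros k.
    rewrite Nat.add_0_r, Rplus_0_r, rGamma'_rec. ring.
  - apply ex_series_exp_bounded with 1. intros k. rewrite Rplus_0_r, <- S_INR.
    apply rGamma_nat_bounded.
Qed.

Lemma besselSeries'_1 (x : R) :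
  Series (fun k => x ^ k / INR (fact k) * rGamma' (k + 2))
  = EulerGamma - 1 + Series (fun n => x ^ S n / INR (fact (S n)) * rGamma' (S n + 2)).
Proof.
  destruct (besselSeries_derive x 1 2) as [H _]; [simpl; ring|].
  rewrite Series_incr_1 by exact H. simpl (0 + 2)%nat. rewrite rGamma'_2.
  f_equal. simpl. field.
Qed.

(** * Principal branches and Bessel functions *)

Lemma Cexp_plus (z w : C) : Cexp (z + w)%C = (Cexp z * Cexp w)%C.
Proof.
  destruct z as [a b], w as [c d]. unfold Cexp, Cmult, Cplus, Re, Im. simpl.
  rewrite exp_plus, cos_plus, sin_plus. f_equal; ring.
Qed.

Lemma Cexp_0 : Cexp 0 = 1.
Proof. unfold Cexp, Re, Im. simpl. rewrite exp_0, cos_0, sin_0.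
  unfold RtoC. f_equal; ring.
Qed.

Lemma Cmod_Cexp (z : C) : Cmod (Cexp z) = exp (Re z).
Proof.
  unfold Cmod, Cexp. simpl fst. simpl snd.
  replace ((exp (Re z) * cos (Im z)) ^ 2 + (exp (Re z) * sin (Im z)) ^ 2)
    with (exp (Re z) * exp (Re z) * (Rsqr (sin (Im z)) + Rsqr (cos (Im z))))
    by (unfold Rsqr; ring).
  rewrite sin2_cos2, Rmult_1_r. apply sqrt_square. left; apply exp_pos.
Qed.

(** Restricting to the closed upper half of the period suffices, because the
    logarithm of a real number has imaginary part 0 or PI. *)
Lemma Cln_Cexp (z : C) : 0 <= Im z <= PI -> Cln (Cexp z) = z.
Proof.
  intros Hz. unfold Cln, Carg. rewrite Cmod_Cexp, ln_exp.
  pose proof (exp_pos (Re z)).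
  destruct Rle_dec as [_|Hn].
  - replace (Re (Cexp z) / exp (Re z)) with (cos (Im z))
      by (unfold Cexp; simpl; field; lra).
    rewrite acos_cos by exact Hz. now destruct z.
  - exfalso. apply Hn. unfold Cexp; simpl. apply Rmult_le_pos; [lra|].
    now apply sin_ge_0.
Qed.

Lemma Carg_real (x : R) : x <> 0 -> Carg (RtoC x) = acos (x / Rabs x).
Proof.
  intros Hx. unfold Carg. rewrite Cmod_R. simpl.
  destruct Rle_dec; [reflexivity|lra].
Qed.

Lemma Im_Cln_real (x : R) : x <> 0 -> 0 <= Im (Cln (RtoC x)) <= PI.
Proof.
  intros Hx. unfold Cln. simpl. rewrite Carg_real by exact Hx. apply acos_bound.
Qed.

Lemma Cexp_Cln_real (x : R) : x <> 0 -> Cexp (Cln (RtoC x)) = RtoC x.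
Proof.
  intros Hx. unfold Cexp, Cln. simpl.
  assert (0 < Rabs x) by now apply Rabs_pos_lt.
  rewrite Cmod_R, exp_ln, Carg_real by easy.
  assert (Hsq : (x / Rabs x) * (x / Rabs x) = 1).
  { unfold Rabs. destruct Rcase_abs; field; lra. }
  rewrite cos_acos, sin_acos by nra.
  unfold Rsqr. rewrite Hsq, Rminus_diag, sqrt_0.
  unfold RtoC. f_equal; [field; lra | ring].
Qed.

(** The power function c |-> z^c, with L a logarithm of z; as the order of a
    Bessel function is real, only real exponents occur. *)
Definition Cexp_ray (L : C) (c : R) : C := Cexp (RtoC c * L)%C.

Lemma Cexp_ray_plus (L : C) (c d : R) :
  Cexp_ray L (c + d) = (Cexp_ray L c * Cexp_ray L d)%C.
Proof.
  unfold Cexp_ray. rewrite <- Cexp_plus, RtoC_plus. f_equal. ring.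
Qed.

Lemma Cexp_ray_0 (L : C) : Cexp_ray L 0 = 1.
Proof. unfold Cexp_ray. rewrite Cmult_0_l. apply Cexp_0. Qed.

Lemma Csqrt_sqr (x : R) : x <> 0 ->
  (Csqrt (RtoC x) * Csqrt (RtoC x))%C = RtoC x.
Proof.
  intros Hx. change (Csqrt (RtoC x)) with (Cexp_ray (Cln (RtoC x)) (1 / 2)).
  rewrite <- Cexp_ray_plus. replace (1 / 2 + 1 / 2) with 1 by field.
  unfold Cexp_ray. rewrite Cmult_1_l. now apply Cexp_Cln_real.
Qed.

(** Halving a logarithm with imaginary part in [0, PI] stays on the principal
    branch, so the power (z / 2)^nu at z = 2 sqrt x is exp (nu L / 2) with
    L = ln x, for negative x as well. *)
Lemma BesselI_sqrt (x nu : R) : x <> 0 ->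
  BesselI nu (2 * Csqrt (RtoC x))%C
  = (Cexp_ray (Cln (RtoC x)) (nu / 2) * RtoC (besselSeries x nu))%C.
Proof.
  intros Hx. unfold BesselI.
  set (L := Cln (RtoC x)). set (w := Csqrt (RtoC x)).
  assert (Hw : w = Cexp_ray L (1 / 2)) by reflexivity.
  assert (H2 : RtoC 2 <> 0) by (intros E; injection E; lra).
  assert (Hww : (w * w = RtoC x)%C).
  { now apply Csqrt_sqr. }
  assert (HL : 0 <= Im L <= PI) by now apply Im_Cln_real.
  f_equal.
  - replace (2 * w / 2)%C with w by field.
    unfold Cpower, Cexp_ray. rewrite Hw. unfold Cexp_ray. rewrite Cln_Cexp.
    + f_equal. rewrite Cmult_assoc, <- RtoC_mult. do 2 f_equal. field.
    + destruct L as [l th]. simpl in *. lra.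
  - replace (2 * w * (2 * w) / 4)%C with (RtoC x).
    2:{ rewrite <- Hww. replace (RtoC 4) with (RtoC 2 * RtoC 2)%C
          by (rewrite <- RtoC_mult; f_equal; ring).
        field. }
    change (RtoC (besselSeries x nu)) with (besselSeries x nu, 0).
    unfold CSeries, besselSeries. f_equal.
    + apply Series_ext. intros k. rewrite <- RtoC_pow, <- RtoC_mult. simpl.
      unfold Rdiv. ring.
    + rewrite <- (Rmult_0_l (Series (fun _ => 0))), <- Series_scal_l.
      apply Series_ext. intros k. rewrite <- RtoC_pow, <- RtoC_mult. simpl. ring.
Qed.

(** L'Hopital's rule at a common zero, with derivative - PI in the
    denominator. *)
Lemma quotient_sin_lim (N : R -> R) (d : R) : is_derive N 1 d -> N 1 = 0 ->
  real (Lim (fun mu => PI / 2 * N mu / sin (mu * PI)) 1) = - (1 / 2) * d.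
Proof.
  intros HN H1.
  assert (Hq : forall (f : R -> R) l, is_derive f 1 l -> f 1 = 0 ->
            is_lim (fun mu => f mu / (mu - 1)) 1 l).
  { intros f l Hf Hf1. apply is_lim_spec. intros eps.
    destruct (proj1 (is_derive_little_o _ _ _) Hf (eps / 2)) as (e & He & H).
    { pose proof (cond_pos eps); lra. }
    exists (mkposreal e He). intros t Ht Hne.
    specialize (H t Ht). rewrite Hf1, Rminus_0_r in H.
    assert (Ht1 : t - 1 <> 0) by lra.
    replace (f t / (t - 1) - l) with ((f t - l * (t - 1)) / (t - 1)) by (field; lra).
    unfold Rdiv. rewrite Rabs_mult, Rabs_inv.
    pose proof (Rabs_pos_lt _ Ht1). pose proof (cond_pos eps).
    apply Rle_lt_trans with (eps / 2); [|lra].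
    apply Rmult_le_reg_r with (Rabs (t - 1)); [easy|].
    rewrite Rmult_assoc, Rinv_l by lra. lra. }
  pose proof PI_RGT_0 as HPI.
  assert (Hs : is_derive (fun mu => sin (mu * PI)) 1 (- PI)).
  { auto_derive; [trivial|]. rewrite Rmult_1_l, cos_PI. ring. }
  assert (Hs1 : sin (1 * PI) = 0) by (rewrite Rmult_1_l; apply sin_PI).
  assert (HL : is_lim (fun mu => PI / 2 * N mu / sin (mu * PI)) 1 (- (1 / 2) * d)).
  { apply is_lim_ext_loc with
      (fun mu => PI / 2 * ((N mu / (mu - 1)) / (sin (mu * PI) / (mu - 1)))).
    - exists (mkposreal 1 Rlt_0_1). intros y Hy Hne.
      apply Rabs_def2 in Hy. unfold minus, plus, opp in Hy; simpl in Hy.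
      assert (sin (y * PI) <> 0).
      { destruct (Rle_lt_dec y 1).
        - apply Rgt_not_eq, sin_gt_0; nra.
        - apply Rlt_not_eq, sin_lt_0; nra. }
      assert (y - 1 <> 0) by (intros E; apply Hne; lra).
      field. now split.
    - replace (Finite (- (1 / 2) * d)) with
        (Rbar_mult (PI / 2) (Rbar_div d (- PI))).
      + apply is_lim_scal_l. apply is_lim_div.
        * now apply Hq.
        * now apply (Hq (fun mu => sin (mu * PI))).
        * intros E. injection E. lra.
        * simpl. exact I.
      + simpl. f_equal. field. lra. }
  now rewrite (is_lim_unique _ _ _ HL).
Qed.

Lemma Cexp_ray_derive (L : C) (c : R) :
  is_derive (fun t => Re (Cexp_ray L t)) c (Re (L * Cexp_ray L c)%C) /\
  is_derive (fun t => Im (Cexp_ray L t)) c (Im (L * Cexp_ray L c)%C).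
Proof.
  destruct L as [l th]. unfold Cexp_ray, Cexp, RtoC, Cmult, Re, Im. simpl.
  split; auto_derive; trivial; unfold Rminus; ring.
Qed.

(** The limit that defines K_1 is taken in the real and the imaginary part
    separately; p stands for either of them, and only its real linearity and the
    derivative of the power function enter. The hypothesis that the two products
    agree says that I_(-1) = I_1, so that the numerator vanishes at mu = 1. *)
Lemma BesselK_1_component (p : C -> R) (L : C) (s : R -> R) (A B : R) :
  (forall z w, p (z - w)%C = p z - p w) ->
  (forall r z, p (RtoC r * z)%C = r * p z) ->
  (forall c, is_derive (fun t => p (Cexp_ray L t)) c (p (L * Cexp_ray L c)%C)) ->
  is_derive s (-1) A -> is_derive s 1 B ->
  (Cexp_ray L (- 1 / 2) * RtoC (s (-1)%R) = Cexp_ray L (1 / 2) * RtoC (s 1))%C ->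
  real (Lim (fun mu => p (RtoC (PI / 2)
     * (Cexp_ray L (- mu / 2) * RtoC (s (- mu)%R) - Cexp_ray L (mu / 2) * RtoC (s mu))
     / RtoC (sin (mu * PI)))%C) 1)
  = p ((L * (Cexp_ray L (1 / 2) * RtoC (s 1))
        + Cexp_ray L (- 1 / 2) * RtoC A + Cexp_ray L (1 / 2) * RtoC B) / 2)%C.
Proof.
  intros Hsub Hscal HE HA HB H0.
  assert (Hscal' : forall z r, p (z * RtoC r)%C = r * p z).
  { intros z r. rewrite Cmult_comm. apply Hscal. }
  assert (Hdiv : forall z r, p (z / RtoC r)%C = p z / r).
  { intros z r. unfold Cdiv.
    replace (/ RtoC r)%C with (RtoC (/ r)).
    { rewrite Hscal'. unfold Rdiv. ring. }
    destruct (Req_dec r 0) as [->|Hr]; [|now apply RtoC_inv].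
    rewrite Rinv_0. unfold Cinv, RtoC. simpl. f_equal; unfold Rdiv; ring. }
  set (N := fun mu => s (- mu) * p (Cexp_ray L (- mu / 2))
                      - s mu * p (Cexp_ray L (mu / 2))).
  transitivity (real (Lim (fun mu => PI / 2 * N mu / sin (mu * PI)) 1)).
  { f_equal. apply Lim_ext. intros mu.
    now rewrite Hdiv, Hscal, Hsub, !Hscal'. }
  assert (Hadd : forall z w, p (z + w)%C = p z + p w).
  { intros z w. replace (z + w)%C with (z - RtoC (-1) * w)%C.
    - rewrite Hsub, Hscal. ring.
    - change (-1) with (- (1)). rewrite RtoC_opp. ring. }
  assert (Hs' : is_derive (fun mu => s (- mu)) 1 (- A)).
  { replace (- A) with (scal (-1) A) by (unfold scal; simpl; unfold mult; simpl; ring).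
    apply (is_derive_comp (V := R_NormedModule) s (fun mu => - mu)).
    - exact HA.
    - auto_derive; trivial. }
  assert (HEm : is_derive (fun mu => p (Cexp_ray L (- mu / 2))) 1
            (- / 2 * p (L * Cexp_ray L (- 1 / 2))%C)).
  { apply (is_derive_comp (V := R_NormedModule) (fun c => p (Cexp_ray L c))
             (fun mu => - mu / 2)).
    - apply HE.
    - auto_derive; [trivial | field]. }
  assert (HEp : is_derive (fun mu => p (Cexp_ray L (mu / 2))) 1
            (/ 2 * p (L * Cexp_ray L (1 / 2))%C)).
  { apply (is_derive_comp (V := R_NormedModule) (fun c => p (Cexp_ray L c))
             (fun mu => mu / 2)).
    - apply HE.
    - auto_derive; [trivial | field]. }
  assert (HN : is_derive N 1
    ((- A * p (Cexp_ray L (- 1 / 2))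
      + s (- (1)) * (- / 2 * p (L * Cexp_ray L (- 1 / 2))%C))
     - (B * p (Cexp_ray L (1 / 2)) + s 1 * (/ 2 * p (L * Cexp_ray L (1 / 2))%C)))).
  { apply (is_derive_minus (V := R_NormedModule)).
    - apply (is_derive_mult (fun mu => s (- mu)) (fun mu => p (Cexp_ray L (- mu / 2))));
        [exact Hs' | exact HEm | intros; apply Rmult_comm].
    - apply (is_derive_mult s (fun mu => p (Cexp_ray L (mu / 2))));
        [exact HB | exact HEp | intros; apply Rmult_comm]. }
  assert (H1 : s (-1) * p (Cexp_ray L (- 1 / 2)) = s 1 * p (Cexp_ray L (1 / 2)))
    by (rewrite <- !Hscal'; now f_equal).
  assert (H2 : s (-1) * p (L * Cexp_ray L (- 1 / 2))%C
               = s 1 * p (L * Cexp_ray L (1 / 2))%C).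
  { rewrite <- !Hscal', <- !Cmult_assoc. now rewrite H0. }
  rewrite (quotient_sin_lim N _ HN).
  - rewrite Hdiv, !Hadd, Cmult_assoc, !Hscal'.
    replace (- (1)) with (-1) by ring. lra.
  - unfold N. replace (- (1)) with (-1) by ring. lra.
Qed.

Lemma BesselK_1_sqrt (x : R) : x <> 0 ->
  BesselK 1 (2 * Csqrt (RtoC x))%C
  = ((Cln (RtoC x) * BesselI 1 (2 * Csqrt (RtoC x))
      + RtoC (Series (fun k => (x ^ k / INR (fact k) * rGamma' (k + 0))%R))
        / Csqrt (RtoC x)
      + Csqrt (RtoC x)
        * RtoC (Series (fun k => (x ^ k / INR (fact k) * rGamma' (k + 2))%R))) / 2)%C.
Proof.
  intros Hx. set (L := Cln (RtoC x)).
  assert (Hw : Csqrt (RtoC x) = Cexp_ray L (1 / 2)) by reflexivity.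
  assert (Hmp : (Cexp_ray L (- 1 / 2) * Cexp_ray L (1 / 2) = 1)%C).
  { rewrite <- Cexp_ray_plus, <- (Cexp_ray_0 L). f_equal. field. }
  assert (Hw0 : Cexp_ray L (1 / 2) <> 0).
  { intros E. rewrite E, Cmult_0_r in Hmp. injection Hmp. lra. }
  destruct (besselSeries_derive x (-1) 0) as [_ HA]; [simpl; ring|].
  destruct (besselSeries_derive x 1 2) as [_ HB]; [simpl; ring|].
  rewrite (BesselI_sqrt x 1 Hx). fold L.
  unfold BesselK, CLim.
  assert (H0 : (Cexp_ray L (- 1 / 2) * RtoC (besselSeries x (-1))
                = Cexp_ray L (1 / 2) * RtoC (besselSeries x 1))%C).
  { rewrite besselSeries_m1, RtoC_mult, <- (Csqrt_sqr x Hx), Hw.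
    transitivity ((Cexp_ray L (- 1 / 2) * Cexp_ray L (1 / 2))
                  * (Cexp_ray L (1 / 2) * RtoC (besselSeries x 1)))%C; [ring|].
    rewrite Hmp. ring. }
  set (K := ((L * (Cexp_ray L (1 / 2) * RtoC (besselSeries x 1))
     + Cexp_ray L (- 1 / 2)
       * RtoC (Series (fun k => (x ^ k / INR (fact k) * rGamma' (k + 0))%R))
     + Cexp_ray L (1 / 2)
       * RtoC (Series (fun k => (x ^ k / INR (fact k) * rGamma' (k + 2))%R))) / 2)%C).
  assert (HK : forall p : C -> R,
    (forall z w, p (z - w)%C = p z - p w) ->
    (forall r z, p (RtoC r * z)%C = r * p z) ->
    (forall c, is_derive (fun t => p (Cexp_ray L t)) c (p (L * Cexp_ray L c)%C)) ->
    real (Lim (fun mu => p (RtoC (PI / 2) * (BesselI (- mu) (2 * Csqrt (RtoC x))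
       - BesselI mu (2 * Csqrt (RtoC x))) / RtoC (sin (mu * PI)))%C) 1) = p K).
  { intros p Hsub Hscal HE.
    etransitivity;
      [|exact (BesselK_1_component p L (besselSeries x) _ _ Hsub Hscal HE HA HB H0)].
    apply (f_equal real), Lim_ext. intros mu. now rewrite !BesselI_sqrt. }
  transitivity K.
  - rewrite (surjective_pairing K). apply f_equal2.
    + apply (HK Re); [reflexivity | | intros c; apply Cexp_ray_derive].
      intros r z. unfold RtoC, Cmult, Re. simpl. ring.
    + apply (HK Im); [reflexivity | | intros c; apply Cexp_ray_derive].
      intros r z. unfold RtoC, Cmult, Im. simpl. ring.
  - unfold K. rewrite Hw.
    replace (Cexp_ray L (- 1 / 2)) with (/ Cexp_ray L (1 / 2))%C.
    + field. exact Hw0.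
    + rewrite <- (Cmult_1_r (/ _)), <- Hmp. field. exact Hw0.
Qed.

Theorem theorem3p4 (x : R) (hx : x <> 0) :
  exists d : R,
    is_derive (fun alpha : R => Wi alpha 2 x) 1 d /\
    RtoC d =
      (1 - RtoC EulerGamma
       - BesselI 0 (2 * Csqrt (RtoC x)) / (2 * RtoC x)
       + (2 * BesselK 1 (2 * Csqrt (RtoC x))
          - Cln (RtoC x) * BesselI 1 (2 * Csqrt (RtoC x)))
         / (2 * Csqrt (RtoC x)))%C.
Proof.
  set (d := Series (fun n => x ^ S n / INR (fact (S n)) * rGamma' (S n + 2))).
  exists d. split; [apply Wi_derive|].
  rewrite BesselK_1_sqrt, (BesselI_sqrt x 0) by exact hx.
  replace (0 / 2) with 0 by field. rewrite Cexp_ray_0.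
  pose proof (besselSeries'_m1 x) as HA.
  rewrite besselSeries'_1 in *. fold d in HA |- *.
  set (A := Series (fun k => x ^ k / INR (fact k) * rGamma' (k + 0))) in *.
  replace A with (besselSeries x 0 + x * (EulerGamma - 1 + d)) by lra.
  set (w := Csqrt (RtoC x)).
  assert (Hww : RtoC x = (w * w)%C).
  { symmetry. now apply Csqrt_sqr. }
  assert (Hw0 : w <> 0).
  { intros E. rewrite E, Cmult_0_l in Hww. injection Hww. exact hx. }
  generalize (BesselI 1 (2 * w)%C). intros I1.
  rewrite !RtoC_plus, RtoC_mult, !RtoC_plus, RtoC_minus, Hww.
  generalize (Cln (RtoC x)). intros L.
  field. exact Hw0.
Qed.
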